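(* If $D$ and $H$ are vertex-disjoint strong digraphs, then $\mathsf{d}_s^-(D\,\square\, H)\ge \max\{\mathsf{d}_s^-(D),\mathsf{d}_s^-(H)\}$.
   Context: Digraphs are finite, loopless, without parallel arcs. A digraph is strong if for every ordered pair $u,v$ there is a directed $uv$-walk. The Cartesian product $D\square H$ has vertex set $V(D)\times V(H)$ and arc $((x,z),(u,v))$ iff either $x=u$ and $(z,v)\in A(H)$, or $z=v$ and $(x,u)\in A(D)$. $S\subseteq V(D)$ is in-dominating if every vertex not in $S$ has an out-neighbor in $S$; strong in-dominating if moreover $D\langle S\rangle$ is strong. $\mathsf{d}_s^-(D)$ is the maximum number of classes of a partition of $V(D)$ into strong in-dominating sets. *)

(* Defs.v *)
From mathcomp Require Import all_boot.

Set Implicit Arguments.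
Unset Strict Implicit.
Unset Printing Implicit Defensive.

(* The record allows the null digraph (no vertices), so that every subset S   *)
(* induces a digraph.                                                         *)
Record digraph := Digraph {
  vertex :> finType;
  darc : rel vertex;
  darc_irr : irreflexive darc
}.

Arguments darc {d} : rename.

Section Digraph.
Variable D : digraph.

(* [connect e u v] holds iff there is a (possibly trivial) [e]-walk from u to *)
(* v, see [connectP].                                                         *)
Definition strong : bool := [forall u : D, forall v : D, connect darc u v].

Section Induced.
Variable S : {set D}.

Definition induced_arc : rel {x : D | x \in S} :=
  fun u v => darc (val u) (val v).

Lemma induced_arc_irr : irreflexive induced_arc.
Proof. by move=> u; apply: darc_irr. Qed.

Definition induced : digraph := Digraph induced_arc_irr.

End Induced.

Definition in_dominating (S : {set D}) : bool :=
  [forall (x : D | x \notin S), exists y in S, darc x y].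

End Digraph.

Definition strong_in_dominating (D : digraph) (S : {set D}) : bool :=
  in_dominating S && strong (induced S).

Definition strong_in_domatic_partition (D : digraph) (P : {set {set D}}) : bool :=
  partition P [set: D] && [forall S in P, strong_in_dominating S].

(* The maximum is over a nonempty family as soon as D is strong and has a     *)
(* vertex, since [set [set: D]] is then such a partition; if there is no such *)
(* partition the value is 0.                                                  *)
Definition strong_in_domatic_number (D : digraph) : nat :=
  \max_(P : {set {set D}} | strong_in_domatic_partition P) #|P|.

Section CartesianProduct.
Variables D H : digraph.

Definition cart_arc : rel (D * H) := fun p q =>
  (p.1 == q.1) && darc p.2 q.2 || (p.2 == q.2) && darc p.1 q.1.

Lemma cart_arc_irr : irreflexive cart_arc.
Proof. by move=> p; rewrite /cart_arc !darc_irr !andbF. Qed.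

Definition cart_prod : digraph := Digraph cart_arc_irr.

End CartesianProduct.

(* Main.v *)
Require Import Defs.
From mathcomp Require Import all_boot.

(** Each class S of a strong in-domatic partition of one factor is pulled back
    to S x V(other factor).  The out-neighbour of a vertex in S is found by
    moving in the first coordinate only, and two vertices of the pulled-back
    class are joined by a walk inside S followed by a walk in the other (strong)
    factor.  Both factors are treated at once by working with a digraph [K]
    carrying product coordinates [pair], [fst'], [snd']. *)

Lemma connect_homo (T T' : finType) (e : rel T) (e' : rel T') (f : T -> T') :
  {homo f : x y / e x y >-> e' x y} ->
  {homo f : x y / connect e x y >-> connect e' x y}.
Proof.
move=> fe x y /connectP[p ep ->]; apply/connectP.
by exists (map f p); rewrite ?last_map // (homo_path fe).
Qed.

(** Covering and disjointness pull back pointwise; surjectivity of [f] keeps the preimage of a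
    nonempty class nonempty. *)
Lemma partition_preimset (T U : finType) (f : T -> U) (P : {set {set U}}) :
  (forall y, exists x, f x = y) -> partition P [set: U] ->
  partition [set f @^-1: S | S : {set U} in P] [set: T].
Proof.
move=> f_surj /and3P[/eqP coverP /trivIsetP trivP P0]; apply/and3P; split.
- apply/eqP/setP=> x; rewrite inE.
  have : f x \in cover P by rewrite coverP inE.
  case/bigcupP=> S SP fxS; apply/bigcupP; exists (f @^-1: S); last by rewrite inE.
  exact: imset_f.
- apply/trivIsetP=> _ _ /imsetP[A AP ->] /imsetP[B BP ->] neqAB.
  have {}neqAB : A != B by apply: contraNneq neqAB => ->.
  by rewrite -setI_eq0 -preimsetI (disjoint_setI0 (trivP _ _ AP BP neqAB)) preimset0.
- apply: contra P0 => /imsetP[S SP S0].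
  suff -> : set0 = S by [].
  apply/setP=> y; have [x <-] := f_surj y.
  by rewrite inE; move/setP/(_ x): S0; rewrite !inE.
Qed.

(** Each [y] is some [f x], so membership of [y] in a set can be read off from membership of [x] in
    its preimage. *)
Lemma preimset_inj (T U : finType) (f : T -> U) :
  (forall y, exists x, f x = y) -> injective (fun S : {set U} => f @^-1: S).
Proof.
move=> f_surj A B /setP eqAB; apply/setP=> y; have [x <-] := f_surj y.
by have := eqAB x; rewrite !inE.
Qed.

Section ProductCoordinates.
Variables (D H K : digraph) (pair : D -> H -> K) (fst' : K -> D) (snd' : K -> H).
Hypotheses (pairK : forall k, pair (fst' k) (snd' k) = k)
  (fst'_pair : forall x z, fst' (pair x z) = x)
  (darc_pairl : forall z, {homo pair^~ z : x u / darc x u})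
  (darc_pairr : forall x, {homo pair x : z w / darc z w}).

Lemma strong_in_dominating_preim (S : {set D}) :
  strong H -> strong_in_dominating S -> strong_in_dominating (fst' @^-1: S).
Proof.
move=> /forallP H_strong /andP[/forallP S_dom /forallP S_strong].
apply/andP; split.
  apply/forallP=> k; apply/implyP; rewrite inE => kS.
  have /existsP[y /andP[yS ky]] := implyP (S_dom (fst' k)) kS.
  apply/existsP; exists (pair y (snd' k)); rewrite inE fst'_pair yS.
  (* Only the tail [k] of the arc is split into coordinates, so both ends share the coordinate
     [snd' k]. *)
  by rewrite -{1}(pairK k) darc_pairl.
have pairS (x : induced S) z : pair (sval x) z \in fst' @^-1: S.
  by rewrite inE fst'_pair (valP x).
(* Corestricting [pair] to the pulled-back class makes it a homomorphism in each coordinate, so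
   walks in [induced S] and in [H] map to walks that never leave the class. *)
pose ipair (x : induced S) z : induced (fst' @^-1: S) :=
  exist _ (pair (sval x) z) (pairS x z).
have ipairl z : {homo ipair^~ z : x u / darc x u}.
  by move=> x u; apply: darc_pairl.
have ipairr x : {homo ipair x : z w / darc z w}.
  by move=> z w; apply: darc_pairr.
have ipair_surj (k : induced (fst' @^-1: S)) : exists x z, k = ipair x z.
  have kS : fst' (val k) \in S by have := valP k; rewrite inE.
  by exists (exist (fun x => x \in S) _ kS), (snd' (val k)); apply: val_inj; rewrite /= pairK.
apply/forallP=> k; apply/forallP=> l.
have [x [z ->]] := ipair_surj k; have [u [w ->]] := ipair_surj l.
apply: (@connect_trans _ _ (ipair u z)).
  exact: (connect_homo _ _ _ _ _ (ipairl z) _ _ (forallP (S_strong x) u)).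
exact: (connect_homo _ _ _ _ _ (ipairr u) _ _ (forallP (H_strong z) w)).
Qed.

Lemma strong_in_domatic_number_coord :
  0 < #|H| -> strong H ->
  strong_in_domatic_number D <= strong_in_domatic_number K.
Proof.
case/card_gt0P=> z0 _ H_strong.
(* The vertex [z0] is where nonemptiness of [H] enters. *)
have fst'_surj x : exists k, fst' k = x by exists (pair x z0).
apply/bigmax_leqP=> P /andP[partP /forallP P_dom].
(* Pulling back merges no classes, so the new partition of [K] has exactly [#|P|] of them and
   competes in the maximum. *)
rewrite -(card_imset _ (preimset_inj _ _ _ fst'_surj)).
apply: leq_bigmax_cond; rewrite /strong_in_domatic_partition.
rewrite partition_preimset //=.
apply/forallP=> A; apply/implyP=> /imsetP[S SP ->].
exact: strong_in_dominating_preim (implyP (P_dom S) SP).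
Qed.

End ProductCoordinates.

Theorem theorem7 (D H : digraph)
  (D_nonempty : 0 < #|D|) (H_nonempty : 0 < #|H|)
  (D_strong : strong D) (H_strong : strong H) :
  maxn (strong_in_domatic_number D) (strong_in_domatic_number H)
    <= strong_in_domatic_number (cart_prod D H).
Proof.
rewrite geq_max; apply/andP; split.
- apply: (@strong_in_domatic_number_coord D H (cart_prod D H)
            (fun x z => (x, z)) fst snd) => //; first by case.
  + by move=> z x u xu; rewrite /= /cart_arc /= eqxx xu orbT.
  + by move=> x z w zw; rewrite /= /cart_arc /= eqxx zw.
(* The factors trade roles: [pair] takes its arguments in swapped order and [snd] becomes the first
   coordinate. *)
- apply: (@strong_in_domatic_number_coord H D (cart_prod D H)
            (fun z x => (x, z)) snd fst) => //; first by case.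
  + by move=> x z w zw; rewrite /= /cart_arc /= eqxx zw.
  + by move=> z x u xu; rewrite /= /cart_arc /= eqxx xu orbT.
Qed.
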